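(* Let $\mathbf D=\langle D,+,',1\rangle$ be an orthogroupoid and let $R$ be the relation on $D$ given by $(a,b)\in R$ iff $a+b=b$. Then $\langle D,R,',1\rangle$ is an orthogonal relational system and $R$ is reflexive.
   Context: An orthogroupoid is an algebra $\mathbf D=\langle D,+,',1\rangle$ of type $(2,1,0)$, with $0:=1'$, satisfying: (a) $x''\approx x$; (b) $0+x\approx x$ and $x+1\approx 1$; (c) $x+x'\approx 1$; (d) for all $x,z$: if $x+z=z$ and $x'+z=z$ then $z=1$; (e) $(((z+y)'+(z+x))'+(z+y)')+z'\approx z'$; (f) $x+(x+y)\approx x+y$ and $y+(x+y)\approx x+y$. A relational system is a pair $\langle A,R\rangle$ with $A\neq\emptyset$ and $R\subseteq A^2$; $U_R(a,b)=\{c:(a,c)\in R,(b,c)\in R\}$. A relational system with 1 and involution is $\langle A,R,',1\rangle$ where $':A\to A$ satisfies $a''=a$ and $(a,b)\in R\Rightarrow(b',a')\in R$, and $1\in A$ satisfies $(x,1)\in R$ for all $x$; put $0=1'$. Elements $a,b$ are orthogonal ($a\perp b$) if $(a,b')\in R$. An element $w\in U_R(a,b)$ is a supremal element for $a,b$ if $(w,z)\in R$ for every $z\in U_R(a,b)$ with $z\neq w$. Such a system is orthogonal if (a) $U_R(x,x')=\{1\}$ for every $x$, and (b) whenever $x\perp y$ and $x\neq 0\neq y$, a supremal element for $x,y$ exists. *)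

(* Defs.v *)
From Stdlib Require Import Relation_Definitions.

Set Implicit Arguments.

Section Orthogroupoid.
Variables (D : Type) (add : D -> D -> D) (inv : D -> D) (one : D).

Local Infix "+" := add.
Local Notation "x ^'" := (inv x) (at level 2, left associativity, format "x ^'").
Local Notation "1" := one.
Local Notation "0" := (inv one).

Record is_orthogroupoid : Prop := {
  og_invK : forall x, x^'^' = x;
  og_add0x : forall x, 0 + x = x;
  og_addx1 : forall x, x + 1 = 1;
  og_addxC : forall x, x + x^' = 1;
  og_unit : forall x z, x + z = z -> x^' + z = z -> z = 1;
  og_ortho : forall x y z,
    (((z + y)^' + (z + x))^' + (z + y)^') + z^' = z^';
  og_addKl : forall x y, x + (x + y) = x + y;
  og_addKr : forall x y, y + (x + y) = x + y }.

Definition induced_rel : relation D := fun a b => a + b = b.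

End Orthogroupoid.

Section RelationalSystem.
Variables (A : Type) (R : relation A).

Definition upper_cone (a b : A) : A -> Prop := fun c => R a c /\ R b c.

(* R need not be reflexive, so R w w is not required. *)
Definition supremal (a b w : A) : Prop :=
  upper_cone a b w /\ forall z, upper_cone a b z -> z <> w -> R w z.

Variables (inv : A -> A) (one : A).

Local Notation "x ^'" := (inv x) (at level 2, left associativity, format "x ^'").
Local Notation "1" := one.
Local Notation "0" := (inv one).

Record is_rel_system_1_inv : Prop := {
  rs_nonempty : inhabited A;
  rs_invK : forall a, a^'^' = a;
  rs_anti : forall a b, R a b -> R b^' a^';
  rs_top : forall x, R x 1 }.

Definition orthogonal (a b : A) : Prop := R a b^'.

Record is_orthogonal_rel_system : Prop := {
  ors_system : is_rel_system_1_inv;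
  ors_compl : forall x c, upper_cone x x^' c <-> c = 1;
  ors_supremal : forall x y, orthogonal x y -> x <> 0 -> y <> 0 ->
    exists w, supremal x y w }.

End RelationalSystem.

(* Main.v *)
(** Axiom (e) does all the work.  With [x = y = b] and [a + b = b] it collapses to
    [b' + a' = a'], so the involution is antitone.  For [x] orthogonal to [y], the
    supremal element is [y + x]: if [c] is above [x] and [y], then [c' + x' = x'] and
    [c' + y' = y'], and instantiating (e) at [z = c'] with the pair [(y', x')] gives
    [(y + x) + c = c]. *)
Require Import Defs.
From Stdlib Require Import Relation_Definitions.

Section OrthogroupoidTheory.
Variables (D : Type) (add : D -> D -> D) (inv : D -> D) (one : D).
Hypothesis HD : is_orthogroupoid add inv one.

(** The second half of (f) with first summand 0, simplified by (b). *)
Lemma add_idem x : add x x = x.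
Proof.
  pose proof (og_addKr HD (inv one) x) as H.
  now rewrite (og_add0x HD) in H.
Qed.

Lemma induced_rel_anti a b :
  induced_rel add a b -> induced_rel add (inv b) (inv a).
Proof.
  unfold induced_rel; intros Hab.
  pose proof (og_ortho HD b b a) as H.
  (* (c) at [b'] gives [b' + b = 1], so the inner complement in (e) becomes 0 and (b) removes it. *)
  pose proof (og_addxC HD (inv b)) as Hb; rewrite (og_invK HD) in Hb.
  now rewrite Hab, Hb, (og_add0x HD) in H.
Qed.

Lemma add_supremal x y : orthogonal (induced_rel add) inv x y ->
  supremal (induced_rel add) x y (add y x).
Proof.
  intros Hxy; split.
  - split; [apply (og_addKr HD) | apply (og_addKl HD)].
  - intros c [Hx Hy] _.
    apply induced_rel_anti in Hx; apply induced_rel_anti in Hy.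
    unfold orthogonal, induced_rel in *.
    (* Orthogonality, [x + y' = y'], turns the inner [(x'' + y')'] into [y]; this is why the sum
       comes out in the order [y + x]. *)
    pose proof (og_ortho HD (inv y) (inv x) (inv c)) as H.
    now rewrite Hx, Hy, !(og_invK HD), Hxy, (og_invK HD) in H.
Qed.

End OrthogroupoidTheory.

Theorem theorem2p10 (D : Type) (add : D -> D -> D) (inv : D -> D) (one : D)
  (HD : is_orthogroupoid add inv one) :
  is_orthogonal_rel_system (induced_rel add) inv one /\
  reflexive D (induced_rel add).
Proof.
  split; [split; [split|..] | exact (add_idem _ _ _ _ HD)].
  - exact (inhabits one).
  - exact (og_invK HD).
  - exact (induced_rel_anti _ _ _ _ HD).
  - exact (og_addx1 HD).
  - intros x c; split.
    (* Read through [induced_rel], the premises of (d) say that [c] lies above both [x] and [x']. *)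
    + intros [Hx Hx']; exact (og_unit HD x Hx Hx').
    + intros ->; split; apply (og_addx1 HD).
  - intros x y Hxy _ _; exists (add y x).
    exact (add_supremal _ _ _ _ HD _ _ Hxy).
Qed.
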